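(* Let $G=(V,E)$ be a finite undirected graph. The family $\Gamma_{\text{fec}}$ of fractional edge covers and the family $\Gamma_{\overline{\text{fec}}}$ of basic fractional edge covers of $G$ are equivalent: $\mathrm{Adm}(\Gamma_{\text{fec}})=\mathrm{Adm}(\Gamma_{\overline{\text{fec}}})$.
   Context: $\delta(v)$ is the set of edges incident to $v$. A fractional edge cover is $\gamma\in\mathbb{R}^E_{\ge0}$ with $\sum_{e\in\delta(v)}\gamma(e)\ge1$ for all $v\in V$. A substar is a subset of some $\delta(v)$; $\mathrm{supp}\,\gamma=\{e:\gamma(e)>0\}$. A basic fractional edge cover is a fractional edge cover $\gamma$ with values in $\{0,1/2,1\}$ whose support is a vertex-disjoint union of odd cycles and substars, and with $\gamma(e)=1/2$ iff $e$ lies on an odd cycle of $\mathrm{supp}\,\gamma$. For a family $\Gamma\subseteq\mathbb{R}^E_{\ge0}$, $\mathrm{Adm}(\Gamma)=\{\rho\in\mathbb{R}^E_{\ge0}:\sum_e\gamma(e)\rho(e)\ge1\ \forall\gamma\in\Gamma\}$. *)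

(* Defs.v *)
From HB Require Import structures.
From mathcomp Require Import all_boot all_order all_algebra.
From mathcomp Require Import classical_sets reals.

Set Implicit Arguments.
Unset Strict Implicit.
Unset Printing Implicit Defensive.

Import Order.TTheory GRing.Theory Num.Theory.
Local Open Scope ring_scope.

(* Parallel edges are allowed ([ends] need not be injective), loops are not;
   simple graphs are the case where [ends] is injective. *)
Record ugraph := UGraph {
  vertex : finType;
  edge : finType;
  ends : edge -> {set vertex};
  card_ends : forall e, #|ends e| = 2%N
}.

Section Graph.
Variable G : ugraph.

Definition delta (v : vertex G) : {set edge G} := [set e | v \in ends e].

Definition substar (A : {set edge G}) : Prop :=
  exists v : vertex G, A \subset delta v.

(* [C] is the edge set e_0, ..., e_(k-1) of a closed walk
   v_0 e_0 v_1 e_1 ... v_(k-1) e_(k-1) v_0 without repetition;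
   [ordS] is the successor modulo [k]. *)
Definition cycle_of_length (k : nat) (C : {set edge G}) : Prop :=
  (1 < k)%N /\
  exists (v : 'I_k -> vertex G) (e : 'I_k -> edge G),
    [/\ injective v, injective e,
        forall i, ends (e i) = [set v i; v (ordS i)]
      & C = [set e i | i : 'I_k]].

Definition odd_cycle (C : {set edge G}) : Prop :=
  exists2 k, odd k & cycle_of_length k C.

Definition vertices_of (A : {set edge G}) : {set vertex G} :=
  \bigcup_(e in A) ends e.

Definition disjoint_union_of_odd_cycles_and_substars (S : {set edge G}) : Prop :=
  exists P : {set {set edge G}},
    [/\ forall A, A \in P -> odd_cycle A \/ substar A,
        forall A B, A \in P -> B \in P -> A != B ->
          [disjoint vertices_of A & vertices_of B]
      & finset.cover P = S].

Variable R : realType.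
Implicit Types (gamma rho : edge G -> R) (Gamma : set (edge G -> R)).

Definition supp gamma : {set edge G} := [set e | 0 < gamma e].

Definition fractional_edge_cover gamma : Prop :=
  (forall e, 0 <= gamma e) /\
  (forall v : vertex G, 1 <= \sum_(e in delta v) gamma e).

Definition basic_fractional_edge_cover gamma : Prop :=
  [/\ fractional_edge_cover gamma,
      forall e, [\/ gamma e = 0, gamma e = 2^-1 | gamma e = 1],
      disjoint_union_of_odd_cycles_and_substars (supp gamma)
    & forall e, gamma e = 2^-1 <->
        exists C, [/\ odd_cycle C, C \subset supp gamma & e \in C]].

Definition Gamma_fec : set (edge G -> R) :=
  [set gamma | fractional_edge_cover gamma]%classic.

Definition Gamma_basic_fec : set (edge G -> R) :=
  [set gamma | basic_fractional_edge_cover gamma]%classic.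

Definition Adm Gamma : set (edge G -> R) :=
  [set rho | (forall e, 0 <= rho e) /\
             forall gamma, Gamma gamma -> 1 <= \sum_e gamma e * rho e]%classic.

End Graph.

Arguments Gamma_fec G R : clear implicits.
Arguments Gamma_basic_fec G R : clear implicits.

(* Main.v *)
Require Import Defs.
From mathcomp Require Import all_boot all_order all_algebra.
From mathcomp Require Import classical_sets reals.
From mathcomp Require Import boolp lra zify.
From mathcomp Require Import fintype finset.

(** Decreasing the support or making more vertex constraints tight without
    increasing the cost replaces a fractional edge cover by an extreme one, so
    it is enough to show that extreme covers are basic.  Let [gamma] be extreme
    with support [H].  Every edge of [H] has a tight end, hence an edge at a
    vertex of [H]-degree one has value one, and its other end either has degree
    one or is not tight.  Let [F] be the edges of [H] with both ends of degree at
    least two, and [T] the tight vertices of degree at least two.  A linear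
    system with [#|F|] unknowns and [#|T|] equations has only the zero
    solution, so [#|F| <= #|T|]; double counting then forces [F] to be
    2-regular on [T] with no other vertex.  The vectors [gamma - 1/2] on [F] and
    an alternating sign on an even cycle are admissible directions, so
    [gamma = 1/2] on [F] and the cycles of [F] are odd. *)

Set Implicit Arguments.
Unset Strict Implicit.
Unset Printing Implicit Defensive.

Import Order.TTheory GRing.Theory Num.Theory.
Local Open Scope ring_scope.

(** * Tools from linear programming and linear algebra *)

Lemma ratio_test (R : realFieldType) (K : finType) (s r : K -> R) :
    (forall k, 0 <= s k) -> (forall k, s k = 0 -> r k = 0) ->
    (exists k, r k < 0) ->
  exists t : R, [/\ 0 <= t, forall k, 0 <= s k + t * r k
    & exists2 k, 0 < s k & s k + t * r k = 0].
Proof.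
move=> s0 r0 [k0 rk0].
(* The step length is the least ratio [s k / - r k] over the decreasing constraints, so the
   minimiser is the first constraint to reach zero. *)
case: (@Order.TotalTheory.arg_minP _ _ _ k0 (fun k => r k < 0)
  (fun k => s k / (- r k)) rk0) => k rk kmin.
have sk : 0 < s k.
  by rewrite lt0r s0 andbT; apply/eqP => /r0 h; rewrite h ltxx in rk.
have rk' : 0 < - r k by rewrite oppr_gt0.
exists (s k / - r k); split.
- by rewrite divr_ge0 // ltW.
- move=> j; case: (ltP (r j) 0) => [rj | rj].
    have rj' : 0 < - r j by rewrite oppr_gt0.
    have := kmin j rj; rewrite ler_pdivlMr // => h.
    by rewrite mulrN in h; lra.
  by rewrite addr_ge0 // mulr_ge0 // divr_ge0 // ltW.
- exists k => //.
  have rk1 : r k != 0 by rewrite lt_eqF.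
  by rewrite invrN mulrN mulNr mulfVK // subrr.
Qed.

(** The matrix has more rows than columns, so its left kernel is nonzero; a kernel row, extended by
    zero outside [A], solves the system. *)
Lemma kernel_vector (R : fieldType) (I J : finType) (A : {set I}) (B : {set J})
    (a : I -> J -> R) :
    (#|B| < #|A|)%N ->
  exists d : I -> R, [/\ exists i, d i != 0, forall i, i \notin A -> d i = 0
    & forall j, j \in B -> \sum_i d i * a i j = 0].
Proof.
move=> ltBA.
pose M := \matrix_(i < #|A|, j < #|B|) a (enum_val i) (enum_val j).
have : kermx M != 0.
  rewrite -mxrank_eq0 mxrank_ker -lt0n subn_gt0.
  exact: leq_ltn_trans (rank_leq_col M) ltBA.
case/rowV0Pn => u /sub_kermxP uM unz.
have [x0 x0A] : exists x, x \in A by apply/card_gt0P; apply: leq_ltn_trans ltBA.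
pose d i := if i \in A then u 0 (enum_rank_in x0A i) else 0.
exists d; split.
- have [i ui] : exists i, u 0 i != 0.
    apply/existsP; apply: contraNT unz; rewrite negb_exists => /forallP h.
    by apply/eqP/rowP => i; rewrite mxE; apply/eqP; move: (h i); rewrite negbK.
  by exists (enum_val i); rewrite /d enum_valP enum_valK_in.
- by move=> i /negbTE; rewrite /d => ->.
- move=> j jB; have := congr1 (fun N : 'rV_#|B| => N 0 (enum_rank_in jB j)) uM.
  rewrite !mxE => h; rewrite -[RHS]h.
  rewrite (bigID (mem A)) /= [X in _ + X]big1 ?addr0; last first.
    by move=> i /negbTE iA; rewrite /d iA mul0r.
  rewrite big_enum_val; apply: eq_bigr => i _.
  by rewrite mxE /d enum_valP enum_valK_in enum_rankK_in.
Qed.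

Lemma ordS_neq (k : nat) (i : 'I_k) : (1 < k)%N -> ordS i != i.
Proof.
move=> k1; apply/eqP => /(congr1 val) /=.
case: (ltnP i.+1 k) => [/modn_small -> | kS]; first by lia.
have -> : i.+1 = k by have := ltn_ord i; lia.
by rewrite modnn => i0; have := ltn_ord i; lia.
Qed.

(** * Edge-vertex incidence *)

Section Incidence.
Variable G : ugraph.
Implicit Types (u v w : vertex G) (e : edge G) (F : {set edge G}).

Lemma other_end v e : v \in ends e -> exists2 u, u != v & ends e = [set v; u].
Proof.
move=> ve; have /eqP/cards2P[x [y [xy E]]] := card_ends e.
move: ve; rewrite E !inE => /orP[] /eqP->; first by exists y => //; rewrite eq_sym.
by exists x => //; rewrite setUC.
Qed.

Lemma ends_pair u v e :
  u != v -> u \in ends e -> v \in ends e -> ends e = [set u; v].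
Proof.
move=> uv ue ve; have [w _ E] := other_end ue.
by move: ve; rewrite E !inE eq_sym (negbTE uv) => /eqP->.
Qed.

(** Handshake lemma: after exchanging the sums, each edge counts once for each of its two ends. *)
Lemma sum_card_delta F : (\sum_v #|F :&: delta v| = 2 * #|F|)%N.
Proof.
transitivity (\sum_v \sum_(e in F) (v \in ends e : nat))%N.
  apply: eq_bigr => v _; rewrite -sum1_card big_mkcond [RHS]big_mkcond /=.
  by apply: eq_bigr => e _; rewrite !inE; case: (e \in F); case: (v \in _).
rewrite exchange_big /= mulnC -sum_nat_const; apply: eq_bigr => e _.
by rewrite -(card_ends e) -sum1_card [RHS]big_mkcond.
Qed.

End Incidence.

(** * Cycles in a 2-regular subgraph *)

Section Walk.
Variables (G : ugraph) (F : {set edge G}) (T : {set vertex G}).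
Hypothesis regF : forall v, v \in T -> #|F :&: delta v| = 2%N.
Hypothesis endsF : forall e, e \in F -> ends e \subset T.

Definition dart (x : vertex G * edge G) := (x.2 \in F) && (x.1 \in ends x.2).

(** Backtracking is excluded on edges rather than on vertices, because two parallel edges form a
    cycle of length two. *)
Definition dart_succ (x y : vertex G * edge G) :=
  [&& dart y, ends x.2 == [set x.1; y.1], x.1 != y.1 & y.2 != x.2].

Lemma dart_succ_exists x : dart x -> exists y, dart_succ x y.
Proof.
case: x => v e /andP[/= eF ve]; have [u uv E] := other_end ve.
have ue : u \in ends e by rewrite E !inE eqxx orbT.
have uT : u \in T by apply: (subsetP (endsF eF)).
have [e' e'F e'e] : exists2 e', e' \in F :&: delta u & e' != e.
  have /eqP/cards2P[x [y [xy Exy]]] := regF uT.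
  case: (eqVneq x e) => [xe | xe].
    by exists y; [rewrite Exy !inE eqxx orbT | rewrite -xe eq_sym].
  by exists x => //; rewrite Exy !inE eqxx.
move: e'F; rewrite !inE => /andP[e'F ue'].
by exists (u, e'); rewrite /dart_succ /dart /= e'F ue' E eqxx eq_sym uv e'e.
Qed.

Lemma infinite_walk v0 : v0 \in T ->
  exists (v : nat -> vertex G) (e : nat -> edge G),
    [/\ v 0 = v0, forall i, e i \in F, forall i, ends (e i) = [set v i; v i.+1],
        forall i, v i != v i.+1 & forall i, e i.+1 != e i].
Proof.
move=> v0T.
have [e0] : exists e, e \in F :&: delta v0 by apply/card_gt0P; rewrite regF.
rewrite !inE => /andP[e0F ve0].
(* The default [x] never occurs along the walk, since every dart has a successor. *)
pose next x := if [pick y | dart_succ x y] is Some y then y else x.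
have nextP x : dart x -> dart_succ x (next x).
  move=> /dart_succ_exists[y xy]; rewrite /next; case: pickP => // /(_ y).
  by rewrite xy.
pose x i := iter i next (v0, e0).
have xP i : dart (x i).
  elim: i => [|i IH]; first by rewrite /dart /= e0F.
  by have /and4P[] := nextP _ IH.
have xS i : dart_succ (x i) (x i.+1) by apply: nextP.
exists (fun i => (x i).1), (fun i => (x i).2); split => //.
- by move=> i; have /andP[] := xP i.
- by move=> i; have /and4P[_ /eqP] := xS i.
- by move=> i; have /and4P[] := xS i.
- by move=> i; have /and4P[] := xS i.
Qed.

(* The first repeated vertex of the walk is its starting point, because a
   repetition elsewhere would give three edges at one vertex. *)
Lemma cycle_through v0 : v0 \in T ->
  exists (k : nat) (v : nat -> vertex G) (e : nat -> edge G),
    [/\ (1 < k)%N, v 0 = v0 & v k = v0] /\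
    [/\ {in gtn k &, injective v}, {in gtn k &, injective e},
        forall i, e i \in F, forall i, ends (e i) = [set v i; v i.+1]
      & forall i e', (i < k)%N -> e' \in F -> v i \in ends e' ->
          exists2 j, (j < k)%N & e' = e j].
Proof.
move=> v0T; have [v [e [v00 eF E vS eS]]] := infinite_walk v0T.
have vT i : v i \in T.
  by apply: (subsetP (endsF (eF i))); rewrite E !inE eqxx.
(* By 2-regularity, two distinct edges at [v i] exhaust the edges of [F] there. *)
have at2 i a b c : e a != e b -> v i \in ends (e a) -> v i \in ends (e b) ->
    c \in F -> v i \in ends c -> c = e a \/ c = e b.
  move=> ab ia ib cF ic.
  have /eqP/cards2P[x [y [xy Exy]]] := regF (vT i).
  have ha : e a \in [set x; y] by rewrite -Exy !inE eF.
  have hb : e b \in [set x; y] by rewrite -Exy !inE eF.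
  have hc : c \in [set x; y] by rewrite -Exy !inE cF.
  move: ha hb hc ab; rewrite !inE.
  by do 3![case/orP => /eqP ->]; rewrite ?eqxx //; auto.
have vi i : v i \in ends (e i) by rewrite E !inE eqxx.
have vi1 i : v i.+1 \in ends (e i) by rewrite E !inE eqxx orbT.
pose rep k := [exists j : 'I_k, v j == v k].
have exrep : exists k, rep k.
  apply: contrapT => norep.
  (* Pigeonhole on the first [#|vertex G|.+1] vertices of the walk. *)
  pose f (i : 'I_#|vertex G|.+1) := v i.
  have injf : injective f.
    move=> i j; rewrite /f => vij; apply/val_inj => /=; apply/eqP.
    apply: contrapT => /negP; rewrite neq_ltn => /orP[] lt; apply: norep.
      by exists j; apply/existsP; exists (Ordinal lt); rewrite /= vij.
    by exists i; apply/existsP; exists (Ordinal lt); rewrite /= vij.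
  by have := leq_card f injf; rewrite card_ord ltnn.
case: (ex_minnP exrep) => k /existsP[[j jk] /= /eqP vjk] kmin.
have vinj : {in gtn k &, injective v}.
  have aux a b : (a < b)%N -> (b < k)%N -> v a <> v b.
    move=> ab bk vab; have : rep b by apply/existsP; exists (Ordinal ab); apply/eqP.
    by move/kmin; rewrite leqNgt bk.
  move=> a b; rewrite !inE => ak bk vab.
  by case: (ltngtP a b) => // h; [case: (aux _ _ h bk) | case: (aux _ _ h ak)].
have k1 : (1 < k)%N.
  case: k jk vjk {kmin vinj} => // [[|//]]; case: j => // _ v01.
  by have := vS 0%N; rewrite v01 eqxx.
have pair i w : v i \in ends (e w) -> v i = v w \/ v i = v w.+1.
  by rewrite E !inE => /orP[] /eqP; auto.
(* If [v k] repeated some [v j.+1], the returning edge [e k.-1] would equal [e j] or [e j.+1]. Each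
   case contradicts injectivity below [k] or the distinctness of consecutive vertices or edges. *)
have j0 : j = 0%N.
  case: j jk vjk => // j jk vjk.
  have kk : k = k.-1.+1 by lia.
  have vk : v j.+1 \in ends (e k.-1) by rewrite vjk {1}kk.
  case: (at2 j.+1 j j.+1 _ _ (vi1 j) (vi _) (eF k.-1) vk) => [|ee|ee].
  - by rewrite eq_sym.
  - have := vi k.-1; rewrite ee => /pair[] h.
      by have := vinj _ _ _ _ h; rewrite !inE => /(_ ltac:(lia) ltac:(lia)); lia.
    by have := vS k.-1; rewrite -kk -vjk h eqxx.
  - have := vi k.-1; rewrite ee => /pair[] h.
      by have := vS k.-1; rewrite -kk -vjk h eqxx.
    case: (ltnP j.+2 k) => lt; last first.
      have jE : k = j.+2 by lia.
      by have := vS j.+1; rewrite vjk jE eqxx.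
    have := vinj _ _ _ _ h; rewrite !inE => /(_ ltac:(lia) ltac:(lia)) h'.
    by have := eS j.+1; rewrite -ee h' eqxx.
subst j; rewrite v00 in vjk.
have einj : {in gtn k &, injective e}.
  (* Comparing the ends of [e a] and [e b] forces [b = a.+1], which would be backtracking. *)
  have aux a b : (a < b)%N -> (b < k)%N -> e a <> e b.
    move=> ab bk ee.
    have := vi a; rewrite ee => /pair[] h.
      by have := vinj _ _ _ _ h; rewrite !inE => /(_ ltac:(lia) ltac:(lia)); lia.
    have := vi b; rewrite -ee => /pair[] h'.
      by have := vinj _ _ _ _ h'; rewrite !inE => /(_ ltac:(lia) ltac:(lia)); lia.
    have bE : b = a.+1.
      by have := vinj _ _ _ _ h'; rewrite !inE => /(_ ltac:(lia) ltac:(lia)); lia.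
    by have := eS a; rewrite -bE ee eqxx.
  move=> a b; rewrite !inE => ak bk ee.
  by case: (ltngtP a b) => // h; [case: (aux _ _ h bk) | case: (aux _ _ h ak)].
exists k, v, e; split; split => // i e' ik e'F ie'.
(* At the starting vertex the two edges are [e 0] and [e k.-1]; at a later one they are the edges
   just before and just after it. *)
case: i ik ie' => [|i] ik ie'.
  have kk : k = k.-1.+1 by lia.
  have v0k : v 0 \in ends (e k.-1) by rewrite v00 vjk {1}kk.
  case: (at2 0 0 k.-1 e' _ (vi 0) v0k e'F ie') => [|->|->].
  - apply/eqP => h; have := einj _ _ _ _ h.
    by rewrite !inE => /(_ ltac:(lia) ltac:(lia)); lia.
  - by exists 0%N => //; lia.
  - by exists k.-1 => //; lia.
case: (at2 i.+1 i i.+1 e' _ (vi1 i) (vi _) e'F ie') => [|->|->].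
- by rewrite eq_sym.
- by exists i => //; lia.
- by exists i.+1.
Qed.

End Walk.

(** * Reduction to extreme covers *)

Section Cover.
Variables (G : ugraph) (R : realType).
Implicit Types (u v w : vertex G) (e : edge G) (f d gamma rho : edge G -> R).

Definition load f v : R := \sum_(e in delta v) f e.

(* Edge constraints [0 <= f e] and vertex constraints [1 <= load f v] are
   handled uniformly: [slack] is the value of a cover on a constraint, and
   [rate] its variation in a direction. *)
Definition slack f (k : edge G + vertex G) : R :=
  match k with inl e => f e | inr v => load f v - 1 end.

Definition rate d (k : edge G + vertex G) : R :=
  match k with inl e => d e | inr v => load d v end.

Lemma loadD f d (t : R) v : load (fun e => f e + t * d e) v = load f v + t * load d v.
Proof. by rewrite /load big_split mulr_sumr. Qed.

Lemma slackD f d (t : R) k :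
  slack (fun e => f e + t * d e) k = slack f k + t * rate d k.
Proof. by case: k => [e|v] //=; rewrite loadD addrAC. Qed.

Lemma fractional_edge_coverP f :
  fractional_edge_cover f <-> forall k, 0 <= slack f k.
Proof.
split=> [[f0 f1] [e|v] //=|h]; first by rewrite subr_ge0; apply: f1.
split=> [e|v]; first exact: (h (inl e)).
by have := h (inr v); rewrite /= subr_ge0.
Qed.

(** For a cover, the linear form of being a vertex of the cover polyhedron: the tight constraints
    have full rank. *)
Definition extreme gamma :=
  forall d, (forall k, slack gamma k = 0 -> rate d k = 0) -> forall e, d e = 0.

(** Its cardinality is the measure that drops during the descent. *)
Definition inactive f : {set edge G + vertex G} := [set k | 0 < slack f k].

(** A decreasing coordinate is needed for the ratio test to stop. If [d] has only one sign, the
    nonpositive choice works because [rho] is nonnegative; if it has both signs, either choice has a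
    decreasing coordinate and the cost decides. *)
Lemma descent_direction rho d : (forall e, 0 <= rho e) -> (exists e, d e != 0) ->
  exists2 c : R, \sum_e c * d e * rho e <= 0 & exists e, c * d e < 0.
Proof.
move=> rho0 [e0 de0].
have cost c : \sum_e c * d e * rho e = c * \sum_e d e * rho e.
  by rewrite mulr_sumr; apply: eq_bigr => e _; rewrite mulrA.
have [[e1 de1]|npos] := pselect (exists e, 0 < d e); last first.
  have d_le0 e : d e <= 0 by rewrite leNgt; apply/negP => h; apply: npos; exists e.
  exists 1; last by exists e0; rewrite mul1r lt_neqAle de0 d_le0.
  by apply: sumr_le0 => e _; rewrite mul1r mulr_le0_ge0.
have [[e2 de2]|nneg] := pselect (exists e, d e < 0); last first.
  have d_ge0 e : 0 <= d e by rewrite leNgt; apply/negP => h; apply: nneg; exists e.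
  exists (-1); last by exists e1; rewrite mulN1r oppr_lt0.
  by rewrite cost mulN1r oppr_le0; apply: sumr_ge0 => e _; rewrite mulr_ge0.
case: (leP (\sum_e d e * rho e) 0) => h.
  by exists 1; [rewrite cost mul1r | exists e2; rewrite mul1r].
by exists (-1); [rewrite cost mulN1r oppr_le0 ltW | exists e1; rewrite mulN1r oppr_lt0].
Qed.

(** Non-extremality gives a direction that keeps the tight constraints tight; moving along it until
    the ratio test stops makes one more constraint tight. *)
Lemma descent_step rho gamma : (forall e, 0 <= rho e) ->
    fractional_edge_cover gamma -> ~ extreme gamma ->
  exists gamma', [/\ fractional_edge_cover gamma',
    \sum_e gamma' e * rho e <= \sum_e gamma e * rho e
    & (#|inactive gamma'| < #|inactive gamma|)%N].
Proof.
move=> rho0 /fractional_edge_coverP cov /existsNP[d0 /not_implyP[d0P /existsNP[e0 /eqP d0e]]].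
have [c costc [e1 ce1]] := descent_direction rho0 (ex_intro _ e0 d0e).
pose d e := c * d0 e.
have rateE k : rate d k = c * rate d0 k.
  by case: k => [e|v] //=; rewrite /load mulr_sumr.
have dP k : slack gamma k = 0 -> rate d k = 0.
  by move=> /d0P; rewrite rateE => ->; rewrite mulr0.
have [t [t0 feas [k sk stk]]] := ratio_test cov dP (ex_intro _ (inl e1) ce1).
exists (fun e => gamma e + t * d e); split.
- by apply/fractional_edge_coverP => j; rewrite slackD.
- under eq_bigr do rewrite mulrDl -mulrA.
  by rewrite big_split /= -mulr_sumr gerDl mulr_ge0_le0.
- apply: proper_card; apply/properP; split.
    apply/subsetP => j; rewrite !inE slackD => h.
    rewrite lt0r cov andbT; apply: contraTneq h => j0.
    by rewrite j0 dP // mulr0 addr0 ltxx.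
  by exists k; rewrite !inE // slackD stk ltxx.
Qed.

Lemma extreme_cover_le rho gamma : (forall e, 0 <= rho e) ->
    fractional_edge_cover gamma ->
  exists gamma', [/\ fractional_edge_cover gamma', extreme gamma'
    & \sum_e gamma' e * rho e <= \sum_e gamma e * rho e].
Proof.
move=> rho0; have [n] := ubnP #|inactive gamma|.
elim: n gamma => // n IH gamma le_n cov.
have [ext|next] := pselect (extreme gamma); first by exists gamma.
have [g [gcov gcost glt]] := descent_step rho0 cov next.
have [g' [? ? g'cost]] := IH g (leq_trans glt le_n) gcov.
by exists g'; split => //; apply: le_trans gcost.
Qed.

End Cover.

(** * Tight vertices and leaf edges of an extreme cover *)

Section ExtremeCover.
Variables (G : ugraph) (R : realType) (gamma : edge G -> R).
Hypotheses (cov : fractional_edge_cover gamma) (ext : extreme gamma).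
Implicit Types (u v w : vertex G) (e : edge G) (d : edge G -> R).

Let H := supp gamma.
Let inc v := H :&: delta v.
Let F := [set e in H | [forall v in ends e, (1 < #|inc v|)%N]].
Let T := [set v | (1 < #|inc v|)%N & load gamma v == 1].

Lemma extreme_eq0 d : (forall e, e \notin H -> d e = 0) ->
  (forall v, load gamma v = 1 -> load d v = 0) -> forall e, d e = 0.
Proof.
move=> dH dT; apply: ext => -[e|v] /=; last by move/subr0_eq/dT.
by move=> e0; apply: dH; rewrite inE e0 ltxx.
Qed.

Lemma load_supp d v : (forall e, e \notin H -> d e = 0) ->
  load d v = \sum_(e in inc v) d e.
Proof.
move=> dH; rewrite /load (bigID (mem H)) /= [X in _ + X]big1 ?addr0.
  by apply: eq_bigl => e; rewrite !inE andbC.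
by move=> e /andP[_ /dH].
Qed.

Lemma gamma_supp e : e \notin H -> gamma e = 0.
Proof.
rewrite inE -leNgt => h; apply/eqP.
by rewrite eq_le h; case: cov => ->.
Qed.

Lemma in_inc e v : (e \in inc v) = (e \in H) && (v \in ends e).
Proof. by rewrite !inE. Qed.

Lemma inc_gt0 v : (0 < #|inc v|)%N.
Proof.
rewrite lt0n cards_eq0; apply/eqP => h.
case: cov => _ /(_ v); rewrite -/(load gamma v) (load_supp _ gamma_supp) h big_set0.
by rewrite ler10.
Qed.

Lemma load_ge e v : e \in inc v -> gamma e <= load gamma v.
Proof.
rewrite (load_supp _ gamma_supp) => ev; rewrite (bigD1 e) //= lerDl.
by apply: sumr_ge0 => e' _; case: cov.
Qed.

(** Otherwise the indicator of [e] would be a nonzero direction respecting all tight constraints. *)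
Lemma exists_tight_end e : e \in H -> exists2 v, v \in ends e & load gamma v = 1.
Proof.
move=> eH; apply: contrapT => no.
have := @extreme_eq0 (fun e' => (e' == e)%:R) _ _ e.
rewrite eqxx => /(_ _ _)/eqP; rewrite oner_eq0 => h; apply: notF; apply: h.
  by move=> e' h; case: eqP => // e'e; rewrite e'e eH in h.
move=> v v1; apply: big1 => e'; rewrite inE => ve'.
by case: eqP => // e'e; case: no; exists v => //; rewrite -e'e.
Qed.

(** The constraint at [v] bounds the value from below by one, and a tight end of [e] bounds it from
    above. *)
Lemma leaf_value v e : inc v = [set e] -> gamma e = 1.
Proof.
move=> vE; have ev : e \in inc v by rewrite vE set11.
have eH : e \in H by move: ev; rewrite in_inc => /andP[].
have [w we w1] := exists_tight_end eH.
apply/eqP; rewrite eq_le -{1}w1 load_ge ?in_inc ?eH //=.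
case: cov => _ /(_ v); rewrite -/(load gamma v) (load_supp _ gamma_supp) vE.
by rewrite big_set1.
Qed.

(** The value one of [e] exhausts the load of the tight vertex [w] and leaves nothing for another
    positive edge. *)
Lemma leaf_neighbour v w e :
  inc v = [set e] -> w \in ends e -> load gamma w = 1 -> inc w = [set e].
Proof.
move=> vE we; have : e \in inc v by rewrite vE set11.
rewrite in_inc => /andP[eH _]; have ew : e \in inc w by rewrite in_inc eH.
rewrite (load_supp _ gamma_supp) (bigD1 e) //= (leaf_value vE) => h.
apply/setP => e'; rewrite inE; case: eqP => [->//|/eqP e'e].
apply/negP => e'w; have e'H : 0 < gamma e'.
  by move: e'w; rewrite in_inc inE => /andP[].
have : 0 < \sum_(i in inc w | i != e) gamma i.
  rewrite (bigD1 e') /= ?e'w //; apply: ltr_wpDr => //.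
  by apply: sumr_ge0 => e'' _; case: cov.
by move: h; lra.
Qed.

Lemma inc_leaf v : (#|inc v| <= 1)%N -> exists e, inc v = [set e].
Proof. by move=> h; apply/cards1P; rewrite eqn_leq h inc_gt0. Qed.

(** If an edge at [v] had an end of degree one, [leaf_neighbour] would force [v] to have degree one
    too. *)
Lemma inc_subF v : v \in T -> inc v \subset F.
Proof.
rewrite inE => /andP[v2 /eqP v1]; apply/subsetP => e.
rewrite in_inc => /andP[eH ve]; rewrite inE eH /=.
apply/forallP => w; apply/implyP => we; rewrite ltnNge; apply/negP.
move=> /inc_leaf[e' wE]; have : e \in inc w by rewrite in_inc eH.
rewrite wE inE => /eqP ee; rewrite -ee in wE.
by rewrite (leaf_neighbour wE ve v1) cards1 in v2.
Qed.

(** * Regularity of [F] and the values of [gamma] *)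

Lemma F_subH e : e \in F -> e \in H.
Proof. by rewrite inE => /andP[]. Qed.

Lemma F_deg e v : e \in F -> v \in ends e -> (1 < #|inc v|)%N.
Proof. by rewrite inE => /andP[_ /forallP/(_ v)/implyP h] /h. Qed.

(** A tight vertex outside [T] meets no edge of [F], so only the equations at [T] remain. *)
Lemma F_direction d : (forall e, e \notin F -> d e = 0) ->
  (forall v, v \in T -> load d v = 0) -> forall e, d e = 0.
Proof.
move=> dF dT; apply: extreme_eq0 => [e eH | v v1].
  by apply: dF; apply: contra eH; apply: F_subH.
case: (boolP (v \in T)) => [/dT //|vT]; apply: big1 => e; rewrite inE => ve.
apply: dF; apply: contra vT => eF.
by rewrite inE v1 eqxx andbT (F_deg eF).
Qed.

Lemma card_F_le : (#|F| <= #|T|)%N.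
Proof.
rewrite leqNgt; apply/negP => lt.
have [d [[e de] dF dT]] := kernel_vector (fun e v => (v \in ends e)%:R : R) lt.
move: de; rewrite (@F_direction d) ?eqxx // => v vT; rewrite -[RHS](dT v vT).
rewrite /load big_mkcond; apply: eq_bigr => e' _; rewrite inE.
by case: ifP; rewrite ?mulr1 ?mulr0.
Qed.

Lemma F_delta v : v \in T -> F :&: delta v = inc v.
Proof.
move=> vT; apply/setP => e; rewrite in_inc; apply/setIP/andP.
  by rewrite [e \in delta v]inE => -[/F_subH ? ?].
move=> [eH ve]; split; last by rewrite inE.
by apply: (subsetP (inc_subF vT)); rewrite in_inc eH.
Qed.

(** Each vertex of [T] has at least two edges of [F], while the degrees sum to
    [2 * #|F| <= 2 * #|T|]; hence equality holds at every vertex, inside and outside [T]. *)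
Lemma card_F_delta v : (#|F :&: delta v| = 2 * (v \in T))%N.
Proof.
have ge w : (2 * (w \in T) <= #|F :&: delta w|)%N.
  case: (boolP (w \in T)) => // wT.
  by rewrite F_delta //; move: wT; rewrite inE => /andP[].
apply/eqP; rewrite eqn_leq ge andbT leqNgt; apply/negP => lt.
have : (\sum_w 2 * (w \in T) < \sum_w #|F :&: delta w|)%N.
  rewrite (bigD1 v) //= [X in (_ < X)%N](bigD1 v) //= -addSn leq_add //.
  by apply: leq_sum => w _.
rewrite sum_card_delta -big_distrr /= ltn_pmul2l // ltnNge.
by rewrite -big_mkcond sum1_card card_F_le.
Qed.

Lemma F_regular v : v \in T -> #|F :&: delta v| = 2%N.
Proof. by move=> vT; rewrite card_F_delta vT. Qed.

Lemma F_ends e : e \in F -> ends e \subset T.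
Proof.
move=> eF; apply/subsetP => v ve; apply: contraT => vT.
have := card_F_delta v; rewrite (negbTE vT) muln0 => /eqP.
by rewrite cards_eq0 => /eqP/setP/(_ e); rewrite in_setI eF in_set ve in_set0.
Qed.

(** At a vertex of [T] the two edges of [F] carry total load one, so [gamma - 2^-1] sums to zero
    there and extremality makes it vanish. *)
Lemma F_value e : e \in F -> gamma e = 2^-1.
Proof.
move=> eF; pose d e := if e \in F then gamma e - 2^-1 else 0.
have : d e = 0.
  apply: F_direction => [e' /negbTE e'F | v vT]; first by rewrite /d e'F.
  rewrite load_supp => [|e']; last first.
    by rewrite /d; case: ifP => // /F_subH ->.
  rewrite -F_delta // (eq_bigr (fun e => gamma e - 2^-1)); last first.
    by move=> e'; rewrite /d inE => /andP[->].
  rewrite big_split /= F_delta // -(load_supp _ gamma_supp) sumr_const.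
  rewrite -F_delta // F_regular // mulr2n.
  have -> : load gamma v = 1 by move: vT; rewrite inE => /andP[_ /eqP].
  by lra.
by rewrite /d eF => /subr0_eq.
Qed.

Lemma leaf_end e : e \in H -> e \notin F -> exists2 v, v \in ends e & inc v = [set e].
Proof.
move=> eH; rewrite inE eH /= => /forallPn[v]; rewrite negb_imply -leqNgt.
case/andP=> ve /inc_leaf[e' vE]; exists v => //.
have : e \in inc v by rewrite in_inc eH.
by rewrite vE in_set1 => /eqP->.
Qed.

Lemma extreme_values e : [\/ gamma e = 0, gamma e = 2^-1 | gamma e = 1].
Proof.
have [eH|/gamma_supp ->] := boolP (e \in H); last by constructor 1.
have [/F_value|eF] := boolP (e \in F); first by constructor 2.
by have [v _ /leaf_value] := leaf_end eH eF; constructor 3.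
Qed.

(* The alternating sign along a closed walk of even length telescopes to zero
   at every vertex. *)
Lemma F_cycle_odd (k : nat) (v : nat -> vertex G) (e : nat -> edge G) :
    (0 < k)%N -> v k = v 0 -> {in gtn k &, injective e} -> (forall i, e i \in F) ->
    (forall i, ends (e i) = [set v i; v i.+1]) ->
  odd k.
Proof.
move=> k0 vk einj eF E; apply: contraT => evk.
pose d e' : R := \sum_(0 <= i < k) (-1) ^+ i * (e i == e')%:R.
have vS i : v i != v i.+1.
  by apply/eqP => h; have := card_ends (e i); rewrite E h setUid cards1.
have : d (e 0) = 0.
  apply: F_direction => [e' e'F | w _].
    apply: big1 => i _; case: eqP => [ee|]; last by rewrite mulr0.
    by rewrite -ee eF in e'F.
  rewrite /load exchange_big /=.
  (* The edge [e i] contributes the indicators of its two ends; the sign change in [(-1) ^+ i.+1]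
     turns their sum into a difference of consecutive terms. *)
  have step i : \sum_(e' in delta w) (-1) ^+ i * (e i == e')%:R =
      - ((-1) ^+ i.+1 * (w == v i.+1)%:R - (-1) ^+ i * (w == v i)%:R) :> R.
    rewrite -mulr_sumr exprS mulN1r mulNr -opprD opprK -mulrDr addrC.
    congr (_ * _); transitivity ((w \in ends (e i))%:R : R).
      rewrite big_mkcond (bigD1 (e i)) //= big1 => [|e' /negbTE h].
        by rewrite inE eqxx addr0; case: ifP.
      by rewrite eq_sym h; case: ifP.
    rewrite E !inE; case: (eqVneq w (v i)) => [->|_]; last by rewrite add0r.
    by rewrite (negbTE (vS i)) addr0.
  under eq_bigr do rewrite step.
  rewrite sumrN telescope_sumr // vk expr0 mul1r.
  by rewrite -signr_odd (negbTE evk) expr0 mul1r subrr oppr0.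
(* By injectivity of [e], only the term of index zero survives in [d (e 0)], which is therefore
   one. *)
rewrite /d big_ltn // eqxx mulr1 expr0 big_nat big1 ?addr0.
  by move/eqP; rewrite oner_eq0.
move=> i /andP[i0 ik]; case: eqP => [ee|]; last by rewrite mulr0.
by have := einj i 0%N; rewrite !inE => /(_ ik k0 ee) i00; rewrite i00 in i0.
Qed.

(** * Components of the support *)

Definition adjacent : rel (vertex G) :=
  [rel u v | [exists e in H, ends e == [set u; v]]].

Definition component v : {set edge G} :=
  [set e in H | [exists w in ends e, connect adjacent v w]].

Lemma adjacentP u v : reflect (exists2 e, e \in H & ends e = [set u; v]) (adjacent u v).
Proof.
apply: (iffP existsP) => [[e /andP[eH /eqP E]]|[e eH E]]; first by exists e.
by exists e; rewrite eH E eqxx.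
Qed.

Lemma connect_adjacent_sym : connect_sym adjacent.
Proof.
apply: sym_connect_sym => u v.
by apply/adjacentP/adjacentP => -[e eH E]; exists e; rewrite // setUC.
Qed.

Lemma connect_ends e u v : e \in H -> u \in ends e -> v \in ends e ->
  connect adjacent u v.
Proof.
move=> eH ue ve; case: (eqVneq u v) => [->|uv]; first exact: connect0.
by apply: connect1; apply/adjacentP; exists e => //; apply: ends_pair.
Qed.

Lemma component_connect v e w : e \in component v -> w \in ends e ->
  connect adjacent v w.
Proof.
rewrite inE => /andP[eH /existsP[u /andP[ue vu]]] we.
exact: connect_trans vu (connect_ends eH ue we).
Qed.

Lemma eq_component u v : connect adjacent u v -> component u = component v.
Proof.
move=> uv; apply/setP => e; rewrite !inE; congr (_ && _).
by apply: eq_existsb => w; rewrite (same_connect connect_adjacent_sym uv).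
Qed.

Lemma component_closed (A : {pred vertex G}) v :
    v \in A ->
    (forall e u w, e \in H -> u \in A -> u \in ends e -> w \in ends e -> w \in A) ->
  forall e w, e \in component v -> w \in ends e -> w \in A.
Proof.
move=> vA clA e w ev we; have := component_connect ev we.
have cl : fingraph.closed adjacent A.
  apply: (intro_closed connect_adjacent_sym) => x y /adjacentP[e' e'H E] xA.
  by apply: (clA e' x) => //; rewrite E !inE eqxx ?orbT.
by move=> /(closed_connect cl) <-.
Qed.

(** At a vertex of [T] all edges of [H] lie in [F], so the cycle of [F] through [v] contains every
    support edge at its vertices and nothing leaves it. *)
Lemma component_odd_cycle v : v \in T -> odd_cycle (component v).
Proof.
move=> vT.
have [k [x [e [[k1 x0 xk] [xinj einj eF E clos]]]]] :=
  cycle_through F_regular F_ends vT.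
have k0 : (0 < k)%N by apply: ltnW.
exists k; first by apply: (F_cycle_odd k0 _ einj eF E); rewrite xk.
split=> //; exists (fun i : 'I_k => x i), (fun i : 'I_k => e i); split.
- by move=> i j /xinj; rewrite !inE => /(_ (ltn_ord i) (ltn_ord j))/val_inj.
- by move=> i j /einj; rewrite !inE => /(_ (ltn_ord i) (ltn_ord j))/val_inj.
- move=> i; rewrite E /=; case: (ltnP i.+1 k) => [/modn_small -> //|ki].
  have -> : i.+1 = k by have := ltn_ord i; lia.
  by rewrite modnn xk x0.
apply/setP => e'; apply/idP/imsetP => [e'v|[i _ ->]]; last first.
  rewrite inE (F_subH (eF i)); apply/existsP; exists (x i).
  rewrite E !inE eqxx -x0 /=; elim: (nat_of_ord i) => [|j IH]; first exact: connect0.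
  by apply: connect_trans IH (connect_ends (F_subH (eF j)) _ _);
    rewrite E !inE eqxx ?orbT.
pose A := [pred w | [exists i : 'I_k, w == x i]].
have AT w : w \in A -> w \in T.
  case/existsP => i /eqP->; apply: (subsetP (F_ends (eF i))).
  by rewrite E !inE eqxx.
have clA e1 u : e1 \in H -> u \in A -> u \in ends e1 -> exists2 j, (j < k)%N & e1 = e j.
  move=> e1H uA ue1; have e1F : e1 \in F.
    by apply: (subsetP (inc_subF (AT u uA))); rewrite in_inc e1H.
  by case/existsP: uA ue1 => i /eqP-> /(clos _ _ (ltn_ord i) e1F).
have [w we'] : exists w, w \in ends e' by apply/card_gt0P; rewrite card_ends.
have e'H : e' \in H by move: e'v; rewrite inE => /andP[].
have wA : w \in A.
  apply: (component_closed _ _ e'v we').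
    by apply/existsP; exists (Ordinal k0); rewrite x0.
  move=> e1 u w' e1H uA ue1 we1; have [j jk ee] := clA _ _ e1H uA ue1.
  move: we1; rewrite ee E !inE => /orP[] /eqP->; apply/existsP.
    by exists (Ordinal jk).
  (* The position after the last one wraps around to [x 0]. *)
  case: (ltnP j.+1 k) => [jk1|kj]; first by exists (Ordinal jk1).
  exists (Ordinal k0); have -> : j.+1 = k by lia.
  by rewrite xk x0.
have [j jk ->] := clA _ _ e'H wA we'.
by exists (Ordinal jk).
Qed.

(** Every edge of [H] meeting [w] or a neighbour of [w] contains [w], so these vertices are closed
    under adjacency. *)
Lemma star_component w :
    (forall e, e \in inc w -> forall u, u \in ends e -> u = w \/ inc u = [set e]) ->
  forall v, v = w \/ adjacent w v -> component v \subset delta w.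
Proof.
move=> leaf v vw.
pose A := [pred u | (u == w) || adjacent w u].
have Aleaf e u : e \in H -> u \in A -> u \in ends e -> w \in ends e.
  move=> eH /orP[/eqP-> //|/adjacentP[e' e'H E]] ue.
  have /leaf : e' \in inc w by rewrite in_inc e'H E !inE eqxx.
  move=> /(_ u); rewrite E !inE eqxx orbT => /(_ isT)[<- //|uE].
  have : e \in inc u by rewrite in_inc eH.
  by rewrite uE inE => /eqP->; rewrite E !inE eqxx.
apply/subsetP => e ev; rewrite inE.
have [u ue] : exists u, u \in ends e by apply/card_gt0P; rewrite card_ends.
have eH : e \in H by move: ev; rewrite inE => /andP[].
apply: (Aleaf _ _ eH _ ue); apply: (component_closed _ _ ev ue).
  by apply/orP; case: vw => [->|]; auto.
move=> e' x y e'H xA xe' ye'; apply/orP.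
have we' := Aleaf _ _ e'H xA xe'; case: (eqVneq y w) => yw; [by left|right].
by apply/adjacentP; exists e' => //; apply: ends_pair; rewrite // eq_sym.
Qed.

(** If [v] has degree at least two, it is the centre: its edges avoid [F], hence have an end of
    degree one other than [v]. If it has degree one, the centre is its neighbour, which is outside
    [T] or is the other end of an isolated edge. *)
Lemma component_substar v : v \notin T -> substar (component v).
Proof.
move=> vT.
have center w : w \notin T -> (1 < #|inc w|)%N ->
    forall e, e \in inc w -> forall u, u \in ends e -> u = w \/ inc u = [set e].
  move=> wT w2 e; rewrite in_inc => /andP[eH we] u ue.
  have eF : e \notin F by apply: contra wT => /F_ends/subsetP; apply.
  have [x xe xE] := leaf_end eH eF.
  have xw : x != w by apply: contraTneq w2 => <-; rewrite xE cards1.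
  by move: ue; rewrite (ends_pair xw xe we) !inE => /orP[] /eqP->; [right | left].
have [v2|/inc_leaf[e vE]] := ltnP 1 #|inc v|.
  by exists v; apply: star_component; [apply: center | left].
have : e \in inc v by rewrite vE set11.
rewrite in_inc => /andP[eH ve]; have [w wv Ee] := other_end ve.
have we : w \in ends e by rewrite Ee !inE eqxx orbT.
have ew : e \in inc w by rewrite in_inc eH.
exists w; apply: star_component; last first.
  by right; apply/adjacentP; exists e => //; rewrite Ee setUC.
have [w2|/inc_leaf[e' wE]] := ltnP 1 #|inc w|.
  apply: center => //; apply/negP => /inc_subF/subsetP/(_ e ew) eF.
  by have := F_deg eF ve; rewrite vE cards1.
move: ew; rewrite wE inE => /eqP <- e1; rewrite inE => /eqP -> u.
by rewrite Ee !inE => /orP[] /eqP->; [right | left].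
Qed.

Lemma extreme_disjoint_union : disjoint_union_of_odd_cycles_and_substars H.
Proof.
exists [set component v | v : vertex G]; split.
- move=> _ /imsetP[v _ ->]; case: (boolP (v \in T)).
    by left; apply: component_odd_cycle.
  by right; apply: component_substar.
- move=> _ _ /imsetP[v _ ->] /imsetP[w _ ->]; apply: contraNT.
  rewrite -setI_eq0 => /set0Pn[x]; rewrite inE => /andP[].
  case/bigcupP => e ev xe /bigcupP[e' e'w xe']; apply/eqP/eq_component.
  apply: connect_trans (component_connect ev xe) _.
  by rewrite connect_adjacent_sym (component_connect e'w).
- apply/setP => e; apply/bigcupP/idP => [[_ /imsetP[v _ ->]]|eH].
    by rewrite inE => /andP[].
  have [w we] : exists w, w \in ends e by apply/card_gt0P; rewrite card_ends.
  exists (component w); first exact: imset_f.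
  by rewrite inE eH; apply/existsP; exists w; rewrite we connect0.
Qed.

(** * Half-valued edges, and the conclusion *)

Lemma odd_cycle_subF (C : {set edge G}) : odd_cycle C -> C \subset H -> C \subset F.
Proof.
case=> k _ [k1 [x [f [xinj finj E CE]]]] CH.
have fH i : f i \in H by apply: (subsetP CH); rewrite CE imset_f.
(* The cycle edges [f (ord_pred i)] and [f i] both meet [x i], and they differ because [1 < k]. *)
have deg i : (1 < #|inc (x i)|)%N.
  have pi : f (ord_pred i) != f i.
    apply/eqP => /finj h; have := ordS_neq (ord_pred i) k1.
    by rewrite ord_predK h eqxx.
  have <- : #|[set f (ord_pred i); f i]| = 2%N by rewrite cards2 pi.
  apply/subset_leq_card/subsetP => e; rewrite in_set2 in_inc.
  by case/orP => /eqP->; rewrite fH E ?ord_predK in_set2 eqxx ?orbT.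
apply/subsetP => e; rewrite CE => /imsetP[i _ ->]; rewrite inE fH /=.
by apply/forallP => v; apply/implyP; rewrite E !inE => /orP[] /eqP->.
Qed.

(** Support edges outside [F] have value one, so the value one half singles out [F], whose
    components are odd cycles. *)
Lemma half_cycleP e : gamma e = 2^-1 <->
  exists C, [/\ odd_cycle C, C \subset H & e \in C].
Proof.
split=> [half|[C [Codd CH eC]]]; last first.
  exact/F_value/(subsetP (odd_cycle_subF Codd CH)).
have eH : e \in H by rewrite inE half invr_gt0 ltr0n.
have eF : e \in F.
  apply: contraT => /(leaf_end eH)[v _ /leaf_value]; rewrite half => /eqP.
  by rewrite invr_eq1 pnatr_eq1.
have [v ve] : exists v, v \in ends e by apply/card_gt0P; rewrite card_ends.
exists (component v); split.
- by apply: component_odd_cycle; apply: (subsetP (F_ends eF)).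
- by apply/subsetP => e'; rewrite inE => /andP[].
- by rewrite inE eH; apply/existsP; exists v; rewrite ve connect0.
Qed.

Lemma extreme_basic : basic_fractional_edge_cover gamma.
Proof.
split=> //; [exact: extreme_values | exact: extreme_disjoint_union |].
exact: half_cycleP.
Qed.

End ExtremeCover.

Theorem theorem1 (R : realType) (G : ugraph) :
  Adm (Gamma_fec G R) = Adm (Gamma_basic_fec G R).
Proof.
apply/seteqP; split=> rho [rho0 adm]; split=> // gamma.
  by case=> cov _ _ _; apply: adm.
(* An extreme cover of no larger cost is basic, so the admissibility of [rho] applies to it. *)
move=> cov; have [g [gcov gext le]] := extreme_cover_le rho0 cov.
by apply: le_trans le; apply: adm; apply: extreme_basic.
Qed.
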